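(* Let $T>0$, $\omega_0=2\pi/T$, $N\ge0$, and let $\mathcal G$ be the single-input/single-output linear time-periodic system $$\dot{\mathbf x}(t)=\mathbf Q\mathbf x(t)+\mathbf b(t)u(t),\qquad y(t)=\mathbf c^T(t)\mathbf x(t),$$ with constant $\mathbf Q\in\mathbb R^{n\times n}$ and $T$-periodic $\mathbf b(t),\mathbf c(t)\in\mathbb R^n$ having finite Fourier expansions $$\mathbf b(t)=\sum_{k=-N}^N\mathbf b_ke^{-\mathrm ik\omega_0t},\qquad\mathbf c(t)=\sum_{k=-N}^N\mathbf c_ke^{-\mathrm ik\omega_0t}.$$ Let $\mathbf V,\mathbf W\in\mathbb R^{n\times r}$ satisfy $\mathbf W^T\mathbf V=\mathbf I$, and define the reduced linear time-periodic system $\widetilde{\mathcal G}$ by $$\dot{\widetilde{\mathbf x}}(t)=\mathbf W^T\mathbf Q\mathbf V\,\widetilde{\mathbf x}(t)+\mathbf W^T\mathbf b(t)u(t),\qquad\widetilde y(t)=\mathbf c^T(t)\mathbf V\,\widetilde{\mathbf x}(t).$$ Let $H$ and $\widetilde H$ be the associated linear time-invariant systems with $2N+1$ inputs and $2N+1$ outputs: $H$ has state, input and output matrices $\mathbf Q$, $[\mathbf b_{-N},\dots,\mathbf b_N]$, $[\mathbf c_{-N},\dots,\mathbf c_N]^T$, and $\widetilde H$ has state, input and output matrices $\mathbf W^T\mathbf Q\mathbf V$, $\mathbf W^T[\mathbf b_{-N},\dots,\mathbf b_N]$, $[\mathbf c_{-N},\dots,\mathbf c_N]^T\mathbf V$.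 Then $$\|\mathcal G-\widetilde{\mathcal G}\|_{\mathcal H_2}\le\sqrt{2N+1}\;\|H-\widetilde H\|_{\mathcal H_2}.$$
   Context: The impulse response of a linear time-periodic system $\dot{\mathbf x}=\mathbf Q\mathbf x+\mathbf b(t)u$, $y=\mathbf c^T(t)\mathbf x$ is $g(t,\tau)=\mathbf c^T(t)e^{\mathbf Q(t-\tau)}\mathbf b(\tau)$ for $t\ge\tau$. The difference of two systems is the system whose impulse response is the difference of the impulse responses. For a time-periodic system $\mathcal G$ with impulse response $g$, $$\|\mathcal G\|_{\mathcal H_2}^2=\frac1T\int_0^T\int_0^\infty|g(t,t-r)|^2\,dr\,dt .$$ A linear time-invariant system with state, input and output matrices $\mathbf A,\mathbf B,\mathbf C$ (i.e. $\dot{\mathbf x}=\mathbf A\mathbf x+\mathbf B\mathbf u$, $\mathbf y=\mathbf C\mathbf x$) has impulse response $\boldsymbol g(t)=\mathbf Ce^{\mathbf At}\mathbf B$, $t\ge0$. For a linear time-invariant system $G$ with impulse response $\boldsymbol g$, $$\|G\|_{\mathcal H_2}^2=\int_0^\infty\mathrm{trace}\big(\boldsymbol g^*(t)\boldsymbol g(t)\big)\,dt,$$ which for stable systems equals $\frac1{2\pi}\int_{-\infty}^\infty\|\mathbf G(\mathrm i\omega)\|_F^2\,d\omega$, where $\mathbf G$ is the transfer function. Both norms are defined by the time-domain integrals and take the value $+\infty$ if the integral diverges. The superscript $T$ on matrices is the transpose without conjugation. *)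

(* Defs.v *)
From mathcomp Require Export all_boot all_order all_algebra.
From mathcomp Require Export all_classical all_reals all_analysis.
From mathcomp Require Export complex.
Export numFieldNormedType.Exports.
Export Order.TTheory GRing.Theory Num.Theory.

Set Implicit Arguments.
Unset Strict Implicit.
Unset Printing Implicit Defensive.

Local Open Scope classical_set_scope.
Local Open Scope ring_scope.
Local Open Scope sesquilinear_scope.

(* The limit is taken in the library's topology on matrices, which is that of
   entrywise convergence. *)
Definition expmx (K : numFieldType) (n : nat) (A : 'M[K]_n) : 'M[K]_n :=
  limn (series (fun k : nat => k`!%:R^-1 *: A ^+ k)).

Definition expi (R : realType) (x : R) : R[i] := Complex (cos x) (sin x).

Definition complexify (R : realType) (m n : nat) (A : 'M[R]_(m, n)) :
    'M[R[i]]_(m, n) :=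
  map_mx (real_complex R) A.

Record ltp_system (R : realType) (n : nat) := LTPSystem {
  ltp_Q : 'M[R]_n;
  ltp_b : R -> 'cV[R]_n;
  ltp_c : R -> 'cV[R]_n }.

(* The impulse response is meaningful for tau <= t only; its values for t < tau
   are never used below. *)
Definition ltp_impulse (R : realType) (n : nat) (G : ltp_system R n)
    (t tau : R) : R :=
  ((ltp_c G t)^T *m expmx ((t - tau) *: ltp_Q G) *m ltp_b G tau) 0 0.

Definition ltp_H2norm (R : realType) (T : R) (g : R -> R -> R) : \bar R :=
  sqrte ((T^-1)%:E *
    \int[lebesgue_measure]_(t in `[0%R, T])
      \int[lebesgue_measure]_(r in `[0%R, +oo[) (`|g t (t - r)| ^+ 2)%:E)%E.

(* The output map c^T V is stored as the column vector V^T c. *)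
Definition ltp_reduce (R : realType) (n r : nat) (V W : 'M[R]_(n, r))
    (G : ltp_system R n) : ltp_system R r :=
  LTPSystem (W^T *m ltp_Q G *m V)
            (fun t => W^T *m ltp_b G t)
            (fun t => V^T *m ltp_c G t).

Record lti_system (K : numFieldType) (n m p : nat) := LTISystem {
  lti_A : 'M[K]_n;
  lti_B : 'M[K]_(n, m);
  lti_C : 'M[K]_(p, n) }.

Definition lti_impulse (K : numFieldType) (n m p : nat)
    (H : lti_system K n m p) (t : K) : 'M[K]_(p, m) :=
  lti_C H *m expmx (t *: lti_A H) *m lti_B H.

(* The trace of h^* h is a nonnegative real number; Re only changes its type. *)
Definition lti_H2norm (R : realType) (p m : nat) (h : R -> 'M[R[i]]_(p, m)) :
    \bar R :=
  sqrte (\int[lebesgue_measure]_(t in `[0%R, +oo[)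
    (complex.Re (\tr ((h t)^t* *m h t)))%:E)%E.

(* 'I_(2N+1) enumerates the harmonics -N, ..., N in increasing order. *)
Definition harmonic_index (N : nat) (k : 'I_(2 * N).+1) : int := k%:Z - N%:Z.

Definition fourier_sum (R : realType) (n N : nat) (omega0 : R)
    (a : int -> 'cV[R[i]]_n) (t : R) : 'cV[R[i]]_n :=
  \sum_(k < (2 * N).+1)
    expi (- ((harmonic_index k)%:~R * omega0 * t)) *: a (harmonic_index k).

(* The matrix [a_{-N}, ..., a_N] *)
Definition harmonic_mx (R : realType) (n N : nat) (a : int -> 'cV[R[i]]_n) :
    'M[R[i]]_(n, (2 * N).+1) :=
  \matrix_(i, k) a (harmonic_index k) i 0.

(* Main.v *)
Require Import Defs.
From mathcomp Require Import measurable_realfun ring.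

Set Implicit Arguments.
Unset Strict Implicit.
Unset Printing Implicit Defensive.

Local Open Scope classical_set_scope.
Local Open Scope ring_scope.

(** Let u(t) be the column of the phases e^{-i k omega0 t}, -N <= k <= N.  The
    Fourier expansions say that b = B u and c = C u for constant matrices B, C,
    so that the impulse response of the difference of the two periodic systems is

      g(t, t - r) = u(t)^T D(r) u(t - r),                        [impulse_factor]

    where D(r) is the impulse response of the difference of the two invariant
    systems.  The coordinates of u(t - r) are 2N+1 complex numbers of modulus 1,
    and the Cauchy-Schwarz inequality gives the pointwise bound

      |g(t, t - r)|^2 <= (2N+1) sum_k |f_k(t)|^2,   f_k(t) = (u(t)^T D(r))_k.

    For fixed r, each f_k is a trigonometric polynomial in t with coefficients
    D(r)_{jk}, hence by Parseval's identity its mean square over a period is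
    sum_j |D(r)_{jk}|^2 [parseval].  Summing over k, the mean over t of
    |g(t, t - r)|^2 is at most (2N+1) ||D(r)||_F^2.  By Tonelli's theorem the
    average in t may be taken before the integral in r, and integrating this bound
    over r >= 0 gives the result [H2norm_le].  Applying the Cauchy-Schwarz inequality
    in the second harmonic index only, and leaving the first to Parseval, is what
    makes the constant 2N+1 and not its square.

    All integrands are nonnegative, so these steps hold in [0, +oo] and only
    measurability has to be checked; for the matrix exponential it follows from the
    convergence of its power series.  The exponentials of a real matrix and of the
    same matrix seen as complex are limits in different spaces; they are identified
    in [expmx_complexify]. *)

(** * The matrix exponential *)

(** The matrix space carries the product topology of its finitely many entries. *)
Lemma cvg_mx_entries (K : numFieldType) m n (u : nat -> 'M[K]_(m, n))
    (M : 'M[K]_(m, n)) :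
  (forall i j, u k i j @[k --> \oo] --> M i j) -> u @ \oo --> M.
Proof.
move=> uM A [P MP PA].
have : \forall k \near \oo, forall i j, P i j (u k i j).
  by do 2![apply: filter_forall => ?]; exact: uM (MP _ _).
by apply: filterS => k ?; exact: PA.
Qed.

(** By induction on [k]: the sum of the moduli of all entries dominates the sum of
    the moduli along each single row. *)
Lemma norm_mxX_entry (R : realType) n (A : 'M[R]_n) k i j :
  `|(A ^+ k) i j| <= (\sum_i \sum_j `|A i j|) ^+ k.
Proof.
set a := \sum_i _.
have rowa i' : \sum_j' `|A i' j'| <= a.
  by rewrite /a [leRHS](bigD1 i') //= lerDl sumr_ge0 // => ? _; exact: sumr_ge0.
elim: k i j => [|k IH] i j.
  by rewrite expr0 expr0 mxE; case: (i == j); rewrite ?normr0 ?normr1.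
rewrite !exprS.
have -> : (A * A ^+ k) i j = \sum_l A i l * (A ^+ k) l j by rewrite mxE.
apply: le_trans (ler_norm_sum _ _ _) _.
apply: le_trans (_ : \sum_l `|A i l| * a ^+ k <= _).
  by apply: ler_sum => l _; rewrite normrM ler_wpM2l.
rewrite -mulr_suml ler_wpM2r // exprn_ge0 //.
by apply: sumr_ge0 => ? _; exact: sumr_ge0.
Qed.

Definition expmx_coeff (R : realType) n (A : 'M[R]_n) i j (k : nat) : R :=
  k`!%:R^-1 * (A ^+ k) i j.

(** Comparison with the scalar exponential series at the sum of the moduli of the
    entries. *)
Lemma is_cvg_expmx_coeff (R : realType) n (A : 'M[R]_n) i j :
  cvgn (series (expmx_coeff A i j)).
Proof.
apply: normed_cvg.
apply: series_le_cvg (is_cvg_series_exp_coeff (\sum_i \sum_j `|A i j|)) => k /=.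
- by [].
- rewrite /exp_coeff /= divr_ge0 // exprn_ge0 //.
  by apply: sumr_ge0 => ? _; exact: sumr_ge0.
- rewrite /exp_coeff /expmx_coeff /= normrM ger0_norm ?invr_ge0 // mulrC.
  by rewrite ler_wpM2r ?invr_ge0 // norm_mxX_entry.
Qed.

Lemma expmxE (R : realType) n (A : 'M[R]_n) i j :
  expmx A i j = limn (series (expmx_coeff A i j)).
Proof.
have -> : expmx A = \matrix_(i, j) limn (series (expmx_coeff A i j)).
  apply: cvg_lim; first exact: norm_hausdorff.
  apply: cvg_mx_entries => {}i {}j; rewrite mxE.
  rewrite [X in X @ _ --> _](_ : _ = series (expmx_coeff A i j)).
    exact: is_cvg_expmx_coeff.
  apply/funext => k; rewrite /series /= summxE.
  by apply: eq_bigr => l _; rewrite mxE.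
by rewrite mxE.
Qed.

Lemma cvg_expmx_entry (R : realType) n (A : 'M[R]_n) i j :
  series (expmx_coeff A i j) k @[k --> \oo] --> expmx A i j.
Proof. by rewrite expmxE; exact: is_cvg_expmx_coeff. Qed.

(** The ascription selects the topology that a numeric field gets from its norm. *)
Lemma continuous_real_complex (R : realType) :
  continuous (real_complex R : R -> (R[i] : numFieldType)).
Proof.
move=> x; apply/cvgrPdist_lt => e e0.
(* The positive elements of R[i] are real. *)
have eE : e = (complex.Re e)%:C%C by rewrite RRe_real // gtr0_real.
have e0' : 0 < complex.Re e by move: e0; rewrite eE ltcR.
near=> y.
rewrite -rmorphB normc_def /= expr0n addr0 sqrtr_sqr eE ltcR.
near: y; exact: cvgr_dist_lt.
Unshelve. all: by end_near. Qed.

Lemma complexify_exp (R : realType) n (A : 'M[R]_n) k :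
  complexify (A ^+ k) = complexify A ^+ k.
Proof.
elim: k => [|k IH]; first by rewrite !expr0 /complexify map_mx1.
by rewrite !exprS -IH; exact: map_mxM.
Qed.

Lemma complexify_scale (R : realType) m n (s : R) (A : 'M[R]_(m, n)) :
  complexify (s *: A) = real_complex R s *: complexify A.
Proof. by apply/matrixP => i j; rewrite !mxE rmorphM. Qed.

(** The two limits are taken in different matrix spaces; since the real series
    converges entrywise, continuity of the inclusion of R into R[i] carries its limit
    over. *)
Lemma expmx_complexify (R : realType) n (A : 'M[R]_n) :
  expmx (complexify A) = complexify (expmx A).
Proof.
apply: cvg_lim; first exact: norm_hausdorff.
apply: cvg_mx_entries => i j; rewrite mxE.
rewrite [X in X @ _ --> _](_ : _ =
    (fun k => real_complex R (series (expmx_coeff A i j) k))).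
  apply: continuous_cvg; last exact: cvg_expmx_entry.
  exact: continuous_real_complex.
apply/funext => k; rewrite /series /= summxE rmorph_sum; apply: eq_bigr => l _.
by rewrite -complexify_exp !mxE rmorphM fmorphV rmorph_nat.
Qed.

(** A pointwise limit of polynomials in t. *)
Lemma measurable_expmx_entry (R : realType) n (A : 'M[R]_n) i j :
  measurable_fun setT (fun t : R => expmx (t *: A) i j : R).
Proof.
apply: (@measurable_realfun.measurable_fun_cvg _ (measurableTypeR R) R setT
  (fun k t => series (expmx_coeff (t *: A) i j) k)).
  move=> k; apply: measurable_sum => l.
  rewrite (_ : (fun _ => _) = (fun t : R => l`!%:R^-1 * (t ^+ l * (A ^+ l) i j))).
    by apply: measurable_funM => //; apply: measurable_funM => //; exact: measurable_funX.
  apply/funext => t; rewrite /expmx_coeff.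
  suff -> : (t *: A) ^+ l = t ^+ l *: A ^+ l by rewrite mxE.
  elim: l => [|l IH]; first by rewrite !expr0 scale1r.
  rewrite !exprS IH -[LHS]/((t *: A) *m (t ^+ l *: A ^+ l)).
  by rewrite -scalemxAl -scalemxAr scalerA.
by move=> t _; exact: cvg_expmx_entry.
Qed.

(** * Factorization of the impulse response *)

Definition phase_col (R : realType) N (omega0 t : R) :
    'cV[R[i]]_((2 * N).+1) :=
  \col_k expi (- ((harmonic_index k)%:~R * omega0 * t)).

Lemma fourier_sumE (R : realType) n N omega0 (a : int -> 'cV[R[i]]_n) t :
  fourier_sum N omega0 a t = harmonic_mx N a *m phase_col N omega0 t.
Proof.
apply/colP => i; rewrite /fourier_sum summxE [RHS]mxE.
by apply: eq_bigr => k _; rewrite !mxE mulrC.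
Qed.

Lemma complexify_mul (R : realType) m n p (A : 'M[R]_(m, n)) (B : 'M[R]_(n, p)) :
  complexify (A *m B) = complexify A *m complexify B.
Proof. exact: map_mxM. Qed.

Lemma complexify_tr (R : realType) m n (A : 'M[R]_(m, n)) :
  complexify A^T = (complexify A)^T.
Proof. by rewrite /complexify map_trmx. Qed.

(** Input and output vectors that factor through the phases leave the impulse
    response of an invariant system in the middle, for real [Q] whose exponential
    can be computed over R[i]. *)
Lemma impulse_factor (R : realType) n m (Q : 'M[R]_n) (b c : 'cV[R]_n)
    (B C : 'M[R[i]]_(n, m)) (u v : 'cV[R[i]]_m) (s : R) :
  complexify b = B *m v -> complexify c = C *m u ->
  real_complex R ((c^T *m expmx (s *: Q) *m b) 0 0) =
  (u^T *m (C^T *m expmx (real_complex R s *: complexify Q) *m B) *m v) 0 0.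
Proof.
move=> bE cE.
have -> : real_complex R ((c^T *m expmx (s *: Q) *m b) 0 0) =
    complexify (c^T *m expmx (s *: Q) *m b) 0 0 by rewrite [RHS]mxE.
by rewrite -complexify_scale expmx_complexify 2!complexify_mul complexify_tr bE cE
  trmx_mul !mulmxA.
Qed.

(** * Squared moduli *)

Definition sqnormc (R : realType) (z : R[i]) : R :=
  complex.Re z ^+ 2 + complex.Im z ^+ 2.

Lemma sqnormc_ge0 (R : realType) (z : R[i]) : 0 <= sqnormc z.
Proof. by rewrite addr_ge0 // sqr_ge0. Qed.

Lemma sqnormcM (R : realType) (z w : R[i]) : sqnormc (z * w) = sqnormc z * sqnormc w.
Proof. by case: z w => [a b] [c d]; rewrite /sqnormc /=; ring. Qed.

Lemma sqnormc_expi (R : realType) (x : R) : sqnormc (expi x) = 1.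
Proof. by rewrite /sqnormc /= cos2Dsin2. Qed.

Lemma Re_mul_conjc (R : realType) (z : R[i]) : complex.Re (z * conjc z) = sqnormc z.
Proof. by case: z => a b; rewrite /sqnormc /=; ring. Qed.

Lemma Re_sum (R : realType) (I : finType) (F : I -> R[i]) :
  complex.Re (\sum_i F i) = \sum_i complex.Re (F i).
Proof. exact: (big_morph _ (fun x y => raddfD (@complex.Re R) x y)). Qed.

(** The integrand of the norm of an invariant system is the squared Frobenius norm. *)
Lemma Re_trace_adjoint (R : realType) p m (D : 'M[R[i]]_(p, m)) :
  complex.Re (\tr (D^t* *m D)%sesqui) = \sum_k \sum_j sqnormc (D j k).
Proof.
rewrite /mxtrace Re_sum; apply: eq_bigr => k _.
rewrite mxE Re_sum; apply: eq_bigr => j _.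
by rewrite !mxE mulrC -Re_mul_conjc.
Qed.

(** The Cauchy-Schwarz inequality against the constant vector 1: the defect is half
    the sum of the squares (x_k - x_l)^2. *)
Lemma sqr_sum_le (R : realType) m (x : 'I_m -> R) :
  (\sum_k x k) ^+ 2 <= m%:R * \sum_k x k ^+ 2.
Proof.
set S := \sum_k x k; set S2 := \sum_k x k ^+ 2.
have inner k : \sum_l (x k - x l) ^+ 2 = m%:R * x k ^+ 2 + (S2 - 2 * x k * S).
  transitivity (\sum_l (x k ^+ 2 + (x l ^+ 2 - 2 * x k * x l))).
    by apply: eq_bigr => l _; ring.
  by rewrite big_split /= sumr_const card_ord -[_ *+ m]mulr_natl sumrB -mulr_sumr.
have total : \sum_k \sum_l (x k - x l) ^+ 2 = 2 * (m%:R * S2 - S ^+ 2).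
  under eq_bigr do rewrite inner.
  rewrite big_split /= sumrB -mulr_suml -!mulr_sumr sumr_const card_ord
    -[_ *+ m]mulr_natl /=.
  by rewrite -/S -/S2; ring.
rewrite -subr_ge0 -(pmulr_rge0 _ (ltr0n _ 2)) -total.
by apply: sumr_ge0 => k _; apply: sumr_ge0 => l _; exact: sqr_ge0.
Qed.

Lemma conjc_expiM (R : realType) (x : R) (z : R[i]) :
  conjc (expi (- x) * z) = expi x * conjc z.
Proof.
case: z => a b; rewrite /expi cosN sinN /=; apply/eqP; rewrite eq_complex /=.
by apply/andP; split; apply/eqP; ring.
Qed.

Lemma expiD (R : realType) (x y : R) : expi (x + y) = expi x * expi y.
Proof.
rewrite /expi cosD sinD; apply/eqP; rewrite eq_complex /=.
by rewrite [X in _ && (X == _)]addrC !eqxx.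
Qed.

Lemma sqnormc_sum (R : realType) m (z : 'I_m -> R[i]) :
  sqnormc (\sum_j z j) = \sum_j \sum_l complex.Re (z j * conjc (z l)).
Proof.
rewrite -Re_mul_conjc mulr_suml Re_sum; apply: eq_bigr => j _.
by rewrite rmorph_sum mulr_sumr Re_sum.
Qed.

(** * Parseval's identity *)

(** A continuous integrand together with a global antiderivative F.  Unlike the
    Lebesgue integral itself, this relation is stable under signed linear
    combinations with no integrability side conditions. *)
Definition has_integral0 (R : realType) (T : R) (f : R -> R) (c : R) :=
  exists F : R -> R, [/\ continuous f, forall t : R, is_derive t 1 F (f t)
    & F T - F 0 = c].

Lemma has_integral0_sum (R : realType) (T : R) m (f : 'I_m -> R -> R) c :
  (forall k, has_integral0 T (f k) (c k)) ->
  has_integral0 T (fun t => \sum_k f k t) (\sum_k c k).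
Proof.
move=> /choice[F FP]; exists (fun t => \sum_k F k t); split.
- move=> t; elim: (index_enum _) => [|k s IH].
    by under eq_fun do rewrite big_nil; exact: cvg_cst.
  under eq_fun do rewrite big_cons; rewrite /continuous_at.
  by apply: cvgD IH; have [+ _ _] := FP k; exact.
- move=> t.
  have : is_derive t 1 (\sum_k F k) (\sum_k f k t).
    by apply: is_derive_sum => k; have [] := FP k.
  by congr is_derive; apply/funext => x; rewrite fct_sumE.
- by rewrite -sumrB; apply: eq_bigr => k _; have [] := FP k.
Qed.

Lemma has_integral0_scale (R : realType) (T a : R) f c :
  has_integral0 T f c -> has_integral0 T (fun t => a * f t) (a * c).
Proof.
move=> [F [cf dF FE]]; exists (fun t => a * F t); split.
- by move=> t; apply: cvgM; [exact: cvg_cst|exact: cf].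
- by move=> t; have := dF t => /(is_deriveZ a).
- by rewrite -mulrBr FE.
Qed.

Lemma is_derive_continuous (R : realType) (F f : R -> R) :
  (forall t : R, is_derive t 1 F (f t)) -> continuous F.
Proof.
by move=> dF t; apply/differentiable_continuous/derivable1_diffP; exact: ex_derive.
Qed.

Lemma integral_has_integral0 (R : realType) (T : R) f c : 0 < T ->
  has_integral0 T f c ->
  (\int[lebesgue_measure]_(t in `[0%R, T]) (f t)%:E = c%:E)%E.
Proof.
move=> T0 [F [cf dF <-]].
have Fc := is_derive_continuous dF.
rewrite (continuous_FTC2 (F := F)) ?EFinB //.
- exact: continuous_subspaceT.
- by split=> [x _||]; [exact: ex_derive|apply: cvg_at_right_filter; exact: Fc
    |apply: cvg_at_left_filter; exact: Fc].
- by move=> x _; rewrite derive1E; exact: derive_val.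
Qed.

Lemma cos_sin_int_period (R : realType) (q : int) :
  cos (q%:~R * (2 * pi) : R) = 1 /\ sin (q%:~R * (2 * pi) : R) = 0.
Proof.
have nat_case (k : nat) : cos (k%:R * (2 * pi) : R) = 1 /\ sin (k%:R * (2 * pi) : R) = 0.
  rewrite (_ : k%:R * (2 * pi) = 0 + (pi *+ 2) *+ k :> R); last first.
    by rewrite add0r -[in RHS]mulr_natl mulr_natl [in RHS]mulr_natl mulr_natl.
  by rewrite (periodicn (@cosD2pi R)) (periodicn (@sinD2pi R)) cos0 sin0.
case: q => k; first exact: nat_case.
by rewrite NegzE mulrNz mulNr cosN sinN; case: (nat_case k.+1) => -> ->; rewrite oppr0.
Qed.

(** Orthogonality of the characters of the circle, in real form. *)
Lemma has_integral0_phase (R : realType) (T omega0 : R) (q : int) (A : R[i]) :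
  0 < T -> omega0 = 2 * pi / T ->
  has_integral0 T (fun t => complex.Re (expi (- (q%:~R * omega0 * t)) * A))
    (if q == 0 then T * complex.Re A else 0).
Proof.
move=> T0 omegaE; case: A => a b /=.
case: eqVneq => [->|q0].
  exists (fun t => a * t); split.
  - move=> t; rewrite (_ : (fun t => _) = cst a); first exact: cvg_cst.
    by apply/funext => s; rewrite !mul0r oppr0 cos0 sin0 mul1r mul0r subr0.
  - move=> t; rewrite !mul0r oppr0 cos0 sin0 mul1r mul0r subr0.
    have : is_derive t 1 (fun t : R => a *: t) (a *: 1) by exact: is_deriveZ.
    by rewrite /GRing.scale /= mulr1.
  - by rewrite mulr0 subr0 mulrC.
(* The frequency; s * T is a multiple of 2 * pi, so the antiderivative a sin / s +
   b cos / s takes the same value at 0 and T. *)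
set s : R := - (q%:~R * omega0).
have s0 : s != 0.
  rewrite oppr_eq0 !mulf_neq0 ?intr_eq0 // omegaE.
  by rewrite mulf_neq0 ?invr_eq0 ?(gt_eqF T0) // mulf_neq0 // gt_eqF // pi_gt0.
have sT : s * T = (- q)%:~R * (2 * pi).
  by rewrite /s omegaE mulrNz; field; rewrite gt_eqF.
have -> : (fun t => cos (- (q%:~R * omega0 * t)) * a - sin (- (q%:~R * omega0 * t)) * b)
   = (fun t => cos (s * t) * a - sin (s * t) * b).
  by apply/funext => t; rewrite /s mulNr.
have ds (t : R) : is_derive t 1 (fun t => s * t) s.
  have : is_derive t 1 (fun t : R => s *: t) (s *: 1) by exact: is_deriveZ.
  by rewrite /GRing.scale /= mulr1.
have dcos (t : R) : is_derive t 1 (fun t => cos (s * t)) (s * - sin (s * t)).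
  have := @is_derive1_comp _ cos (fun t => s * t) t _ _ (is_derive_cos (s * t)) (ds t).
  by rewrite mulrC.
have dsin (t : R) : is_derive t 1 (fun t => sin (s * t)) (s * cos (s * t)).
  have := @is_derive1_comp _ sin (fun t => s * t) t _ _ (is_derive_sin (s * t)) (ds t).
  by rewrite mulrC.
exists (fun t => (a / s) * sin (s * t) + (b / s) * cos (s * t)); split.
- move=> t; apply: cvgB; apply: cvgM; try exact: cvg_cst.
    exact: (is_derive_continuous dcos).
  exact: (is_derive_continuous dsin).
- move=> t.
  have := is_deriveD (is_deriveZ (a / s) (dsin t)) (is_deriveZ (b / s) (dcos t)).
  congr is_derive; rewrite /GRing.scale /=; field; exact: s0.
- have [c1 s1] := cos_sin_int_period R (- q).
  by rewrite sT c1 s1 !mulr0 cos0 sin0 !mulr0 subrr.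
Qed.

(** Expanding the squared modulus gives the phases of index p_j - p_l; only the
    diagonal terms survive integration over a period, by injectivity of p. *)
Lemma parseval (R : realType) (T omega0 : R) m (p : 'I_m -> int) (a : 'I_m -> R[i]) :
  0 < T -> omega0 = 2 * pi / T -> injective p ->
  has_integral0 T (fun t => sqnormc (\sum_j expi (- ((p j)%:~R * omega0 * t)) * a j))
    (T * \sum_j sqnormc (a j)).
Proof.
move=> T0 omegaE p_inj.
have -> : (fun t => sqnormc (\sum_j expi (- ((p j)%:~R * omega0 * t)) * a j)) =
  (fun t => \sum_j \sum_l complex.Re
    (expi (- ((p j - p l)%:~R * omega0 * t)) * (a j * conjc (a l)))).
  apply/funext => t; rewrite sqnormc_sum; apply: eq_bigr => j _; apply: eq_bigr => l _.
  rewrite conjc_expiM mulrACA -expiD.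
  by congr (complex.Re (expi _ * _)); rewrite intrB; ring.
rewrite mulr_sumr; apply: has_integral0_sum => j.
have -> : T * sqnormc (a j) =
    \sum_l (if p j - p l == 0 then T * complex.Re (a j * conjc (a l)) else 0).
  rewrite (bigD1 j) //= subrr eqxx Re_mul_conjc big1 ?addr0 // => l lj.
  by rewrite subr_eq0 (inj_eq p_inj) eq_sym (negbTE lj).
by apply: has_integral0_sum => l; exact: has_integral0_phase.
Qed.

(** * Measurability and Tonelli's theorem *)

(** Tonelli's theorem on a rectangle combined with a bound on the fibers.  Extending
    the integrand by 0 outside the rectangle reduces it to the full product space,
    where the fiber integrals are known to be measurable. *)
Lemma tonelli_le d1 d2 (T1 : measurableType d1) (T2 : measurableType d2)
    (R : realType) (m1 : {sigma_finite_measure set T1 -> \bar R})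
    (m2 : {sigma_finite_measure set T2 -> \bar R}) (A : set T1) (B : set T2)
    (f : T1 * T2 -> \bar R) (h : T2 -> \bar R) :
  measurable A -> measurable B -> measurable_fun setT f ->
  (forall x, 0 <= f x)%E -> measurable_fun B h ->
  (forall y, B y -> \int[m1]_(x in A) f (x, y) <= h y)%E ->
  (\int[m1]_(x in A) \int[m2]_(y in B) f (x, y) <= \int[m2]_(y in B) h y)%E.
Proof.
move=> mA mB mf f0 mh fh.
pose f' := f \_ (A `*` B).
have mf' : measurable_fun setT f'.
  apply/(measurable_restrictT _ _).1; first exact: measurableX.
  exact: measurable_funTS.
have f'0 x : (0 <= f' x)%E by apply: erestrict_ge0.
have -> : (\int[m1]_(x in A) \int[m2]_(y in B) f (x, y) =
           \int[m1]_x \int[m2]_y f' (x, y))%E.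
  rewrite integral_mkcond; apply: eq_integral => x _.
  rewrite patchE; case: ifPn => xA.
    rewrite integral_mkcond; apply: eq_integral => y _.
    by rewrite /f' !patchE in_setX xA.
  rewrite integral0_eq // => y _.
  by rewrite /f' patchE in_setX (negbTE xA).
rewrite fubini_tonelli // [leRHS]integral_mkcond.
apply: ge0_le_integral => //.
- by move=> y _; apply: integral_ge0.
- exact: measurable_fun_fubini_tonelli_G.
- exact/(measurable_restrictT _ _).1.
move=> y _; rewrite patchE; case: ifPn => yB.
  apply: le_trans (fh y (set_mem yB)); rewrite [leRHS]integral_mkcond.
  rewrite le_eqVlt; apply/orP; left; apply/eqP; apply: eq_integral => x _.
  by rewrite /f' !patchE in_setX yB andbT.
rewrite integral0_eq // => x _.
by rewrite /f' patchE in_setX (negbTE yB) andbF.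
Qed.

(** Measurability for the Borel sets of the plane, expressed in coordinates. *)
Definition cmeasurable d (T : measurableType d) (R : realType) (f : T -> R[i]) :=
  measurable_fun setT (fun x => complex.Re (f x)) /\
  measurable_fun setT (fun x => complex.Im (f x)).

Section cmeasurable_theory.
Context d (T : measurableType d) (R : realType).
Implicit Types f g : T -> R[i].

Lemma cmeasurable_cst (z : R[i]) : cmeasurable (fun _ : T => z).
Proof. by split; exact: measurable_cst. Qed.

Lemma cmeasurable_real (f : T -> R) :
  measurable_fun setT f -> cmeasurable (fun x => real_complex R (f x)).
Proof. by move=> mf; split => //; exact: measurable_cst. Qed.

Lemma cmeasurableM f g :
  cmeasurable f -> cmeasurable g -> cmeasurable (fun x => f x * g x).
Proof.
move=> [fR fI] [gR gI]; split.
  rewrite (_ : (fun x => _) = (fun x => complex.Re (f x) * complex.Re (g x) -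
      complex.Im (f x) * complex.Im (g x))).
    by apply: measurable_funB; exact: measurable_funM.
  by apply/funext => x; case: (f x) (g x) => [? ?] [? ?].
rewrite (_ : (fun x => _) = (fun x => complex.Re (f x) * complex.Im (g x) +
    complex.Im (f x) * complex.Re (g x))).
  by apply: measurable_funD; exact: measurable_funM.
by apply/funext => x; case: (f x) (g x) => [? ?] [? ?].
Qed.

Lemma cmeasurableD f g :
  cmeasurable f -> cmeasurable g -> cmeasurable (fun x => f x + g x).
Proof.
move=> [fR fI] [gR gI]; split.
  rewrite (_ : (fun x => _) = (fun x => complex.Re (f x) + complex.Re (g x))).
    exact: measurable_funD.
  by apply/funext => x; case: (f x) (g x) => [? ?] [? ?].
rewrite (_ : (fun x => _) = (fun x => complex.Im (f x) + complex.Im (g x))).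
  exact: measurable_funD.
by apply/funext => x; case: (f x) (g x) => [? ?] [? ?].
Qed.

Lemma cmeasurable_sum (I : Type) (s : seq I) (f : I -> T -> R[i]) :
  (forall i, cmeasurable (f i)) -> cmeasurable (fun x => \sum_(i <- s) f i x).
Proof.
move=> mf; elim: s => [|i s IH].
  by under eq_fun do rewrite big_nil; exact: cmeasurable_cst.
by under eq_fun do rewrite big_cons; exact: cmeasurableD.
Qed.

Lemma cmeasurableB f g :
  cmeasurable f -> cmeasurable g -> cmeasurable (fun x => f x - g x).
Proof.
move=> mf mg; under eq_fun do rewrite -mulN1r.
by apply: cmeasurableD => //; apply: cmeasurableM => //; exact: cmeasurable_cst.
Qed.

Lemma measurable_sqnormc f :
  cmeasurable f -> measurable_fun setT (fun x => sqnormc (f x)).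
Proof. by move=> [fR fI]; apply: measurable_funD; exact: measurable_funX. Qed.

Lemma cmeasurable_expi (f : T -> R) :
  measurable_fun setT f -> cmeasurable (fun x => expi (f x)).
Proof.
move=> mf; split; apply: measurableT_comp mf; apply: continuous_measurable_fun.
  exact: continuous_cos.
exact: continuous_sin.
Qed.

Lemma cmeasurable_mulmx m n p (A : T -> 'M[R[i]]_(m, n)) (B : T -> 'M[R[i]]_(n, p)) :
  (forall i j, cmeasurable (fun x => A x i j)) ->
  (forall i j, cmeasurable (fun x => B x i j)) ->
  forall i j, cmeasurable (fun x => (A x *m B x) i j).
Proof.
move=> mA mB i j; under eq_fun do rewrite mxE.
by apply: cmeasurable_sum => k; exact: cmeasurableM.
Qed.

End cmeasurable_theory.

Lemma cmeasurable_comp d1 d2 (T1 : measurableType d1) (T2 : measurableType d2)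
    (R : realType) (f : T2 -> R[i]) (h : T1 -> T2) :
  cmeasurable f -> measurable_fun setT h -> cmeasurable (fun x => f (h x)).
Proof.
move=> [fR fI] mh.
by split; [exact: measurableT_comp fR mh|exact: measurableT_comp fI mh].
Qed.

Lemma cmeasurable_lti_impulse (R : realType) n m p (A : 'M[R]_n)
    (B : 'M[R[i]]_(n, m)) (C : 'M[R[i]]_(p, n)) j k :
  cmeasurable (fun t : R =>
    lti_impulse (LTISystem (complexify A) B C) (real_complex R t) j k).
Proof.
rewrite /lti_impulse /=.
under eq_fun do rewrite -complexify_scale expmx_complexify.
have mconst q l (M : 'M[R[i]]_(q, l)) i' j' :
  cmeasurable (fun _ : R => M i' j') by exact: cmeasurable_cst.
apply: cmeasurable_mulmx => // {}j {}k; apply: cmeasurable_mulmx => // {}j {}k.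
under eq_fun do rewrite mxE.
by apply: cmeasurable_real; exact: measurable_expmx_entry.
Qed.

(** * The norm inequality *)

Lemma harmonic_index_inj N : injective (@harmonic_index N).
Proof. by move=> j k /addIr [] /ord_inj. Qed.

(** The analytic core, in which D may be any measurable family of matrices. *)
Lemma H2norm_le (R : realType) (T omega0 : R) N
    (D : R -> 'M[R[i]]_((2 * N).+1)) (g : R -> R -> R) :
  0 < T -> omega0 = 2 * pi / T ->
  (forall j k, cmeasurable (fun r => D r j k)) ->
  (forall t r, real_complex R (g t (t - r)) =
    ((phase_col N omega0 t)^T *m D r *m phase_col N omega0 (t - r)) 0 0) ->
  (ltp_H2norm T g <= (Num.sqrt ((2 * N).+1%:R : R))%:E * lti_H2norm D)%E.
Proof.
move=> T0 omegaE mD gE.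
set m := (2 * N).+1.
pose f r k t := \sum_j expi (- ((harmonic_index j)%:~R * omega0 * t)) * D r j k.
pose E r := \sum_k \sum_j sqnormc (D r j k).
have E0 r : 0 <= E r by do 2![apply: sumr_ge0 => ? _]; exact: sqnormc_ge0.
have mE : measurable_fun setT E.
  by apply: measurable_sum => k; apply: measurable_sum => j; exact: measurable_sqnormc.
pose G (x : R * R) : R := `|g x.1 (x.1 - x.2)| ^+ 2.
have mphase (k : 'I_m) :
    cmeasurable (fun t : R => expi (- ((harmonic_index k)%:~R * omega0 * t))).
  by apply: cmeasurable_expi; apply: measurable_funN; exact: measurable_funM.
have mG : measurable_fun setT G.
  have mg : cmeasurable (fun x : R * R => real_complex R (g x.1 (x.1 - x.2))).
    under eq_fun do rewrite gE.
    apply: cmeasurable_mulmx => [i j|i j].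
      apply: cmeasurable_mulmx => [{}i {}j|{}i {}j].
        under eq_fun do rewrite !mxE.
        exact: cmeasurable_comp (mphase _) measurable_fst.
      exact: cmeasurable_comp (mD _ _) measurable_snd.
    under eq_fun do rewrite !mxE.
    by apply: cmeasurable_comp (mphase _) _; exact: measurable_funB.
  rewrite (_ : G = (fun x => g x.1 (x.1 - x.2) ^+ 2)).
    by apply: measurable_funX; case: mg.
  by apply/funext => x; rewrite /G real_normK ?num_real.
(* Cauchy-Schwarz in the harmonic of the input only.  As g is real, it is the sum of
   the real parts of the terms, and the real inequality suffices. *)
have Gle t r : G (t, r) <= m%:R * \sum_k sqnormc (f r k t).
  have -> : G (t, r) = (\sum_k complex.Re (f r k t *
      expi (- ((harmonic_index k)%:~R * omega0 * (t - r))))) ^+ 2.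
    rewrite /G /= real_normK ?num_real // -Re_sum; congr (_ ^+ 2).
    rewrite -[LHS]/(complex.Re (real_complex R (g t (t - r)))) gE mxE.
    congr complex.Re; apply: eq_bigr => k _; rewrite !mxE; congr (_ * _).
    by apply: eq_bigr => j _; rewrite !mxE.
  apply: le_trans (sqr_sum_le _) _; rewrite ler_wpM2l //.
  apply: ler_sum => k _; set e := expi _.
  have -> : sqnormc (f r k t) = sqnormc (f r k t * e).
    by rewrite sqnormcM sqnormc_expi mulr1.
  by rewrite [leRHS]/sqnormc lerDl sqr_ge0.
have mean r :
    has_integral0 T (fun t => m%:R * \sum_k sqnormc (f r k t)) (m%:R * (T * E r)).
  apply: has_integral0_scale; rewrite /E mulr_sumr; apply: has_integral0_sum => k.
  by apply: parseval => //; exact: harmonic_index_inj.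
have fiber r : (\int[lebesgue_measure]_(t in `[0%R, T]) (G (t, r))%:E <=
    (m%:R * T)%:E * (E r)%:E)%E.
  rewrite -EFinM -mulrA -(integral_has_integral0 T0 (mean r)).
  apply: ge0_le_integral => //.
  - by move=> t _; rewrite lee_fin sqr_ge0.
  - apply/measurable_EFinP; apply: measurable_funTS.
    by apply: measurableT_comp mG _; exact: measurable_pair2.
  - apply/measurable_EFinP; apply: measurable_funTS.
    by apply: continuous_measurable_fun; case: (mean r) => ? [].
  - by move=> t _; rewrite lee_fin.
have I0 : (0 <= \int[lebesgue_measure]_(r in `[0%R, +oo[) (E r)%:E)%E.
  by apply: integral_ge0 => r _; rewrite lee_fin.
have main : (\int[lebesgue_measure]_(t in `[0%R, T])
      \int[lebesgue_measure]_(r in `[0%R, +oo[) (G (t, r))%:E <=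
    (m%:R * T)%:E * \int[lebesgue_measure]_(r in `[0%R, +oo[) (E r)%:E)%E.
  rewrite -ge0_integralZl //.
  - apply: (@tonelli_le _ _ _ _ R lebesgue_measure lebesgue_measure _ _
        (fun x => (G x)%:E)) => //.
    + exact/measurable_EFinP.
    + by move=> x; rewrite lee_fin sqr_ge0.
    + by apply: measurable_funeM; apply/measurable_EFinP; exact: measurable_funTS.
  - by apply/measurable_EFinP; exact: measurable_funTS.
  - by move=> r _; rewrite lee_fin.
  - by rewrite lee_fin mulr_ge0 // ltW.
rewrite /ltp_H2norm /lti_H2norm.
under [in leRHS]eq_integral do rewrite Re_trace_adjoint.
rewrite -[X in (_ <= X * _)%E]/(sqrte (m%:R)%:E) -sqrteM ?lee_fin //.
rewrite lee_sqrt; last by rewrite mule_ge0 // lee_fin.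
apply: le_trans (lee_wpmul2l _ main) _; first by rewrite lee_fin invr_ge0 ltW.
by rewrite muleA -EFinM mulrCA mulVf ?mulr1 // gt_eqF.
Qed.

Theorem corollary4p2 (R : realType) (T omega0 : R) (N n r : nat)
    (Q : 'M[R]_n) (b c : R -> 'cV[R]_n) (bF cF : int -> 'cV[R[i]]_n)
    (V W : 'M[R]_(n, r))
    (T_gt0 : 0 < T) (omega0E : omega0 = 2 * pi / T)
    (b_periodic : periodic b T) (c_periodic : periodic c T)
    (b_fourier : forall t : R, complexify (b t) = fourier_sum N omega0 bF t)
    (c_fourier : forall t : R, complexify (c t) = fourier_sum N omega0 cF t)
    (WV : W^T *m V = 1%:M) :
  let G := LTPSystem Q b c in
  let G' := ltp_reduce V W G in
  let H := LTISystem (complexify Q) (harmonic_mx N bF) (harmonic_mx N cF)^T in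
  let H' := LTISystem (complexify (W^T *m Q *m V))
                      ((complexify W)^T *m harmonic_mx N bF)
                      ((harmonic_mx N cF)^T *m complexify V) in
  (ltp_H2norm T (fun t tau : R => (ltp_impulse G t tau - ltp_impulse G' t tau)%R)
   <= (Num.sqrt ((2 * N).+1%:R : R))%:E *
      lti_H2norm (fun t : R => (lti_impulse H (real_complex R t)
                                - lti_impulse H' (real_complex R t))%R))%E.
Proof.
cbv zeta.
apply: (H2norm_le (omega0 := omega0)) => // [j k|t s].
  under eq_fun do rewrite mxE [X in _ + X]mxE.
  by apply: cmeasurableB; exact: cmeasurable_lti_impulse.
have bE := fun tau => etrans (b_fourier tau) (fourier_sumE N omega0 bF tau).
have cE := fun tau => etrans (c_fourier tau) (fourier_sumE N omega0 cF tau).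
have WbE tau : complexify (W^T *m b tau) =
    ((complexify W)^T *m harmonic_mx N bF) *m phase_col N omega0 tau.
  by rewrite complexify_mul complexify_tr bE mulmxA.
have VcE tau : complexify (V^T *m c tau) =
    ((complexify V)^T *m harmonic_mx N cF) *m phase_col N omega0 tau.
  by rewrite complexify_mul complexify_tr cE mulmxA.
rewrite mulmxBr mulmxBl rmorphB.
rewrite /ltp_impulse /= subKr (impulse_factor _ _ (bE _) (cE _)).
rewrite (impulse_factor _ _ (WbE _) (VcE _)) trmx_mul trmxK.
by rewrite [RHS]mxE [X in _ = _ + X]mxE.
Qed.
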